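(* Let $V:\mathbb{R}^n\to\mathbb{R}$ be a smooth function and let $N_V=\#(\mathcal{S}_V)$, where $\mathcal{S}_V=\{\bm{x}\in\mathbb{R}^n \mid \nabla_{\bm{x}}V(\bm{x})=\bm{0}\}$, denote the number of its gradient roots. Let $\phi:\mathbb{R}^n\to\mathbb{R}^n$ be an orientation-preserving diffeomorphism, i.e. a diffeomorphism whose Jacobian $\bm{J}_\phi(\bm{x})\in\mathbb{R}^{n\times n}$ satisfies $\det(\bm{J}_\phi(\bm{x}))>0$ for all $\bm{x}\in\mathbb{R}^n$. Then the number of gradient roots is invariant under $\phi$: with $U:=V\circ\phi$ and $N_U=\#(\mathcal{S}_U)$, $\mathcal{S}_U=\{\bm{x}\in\mathbb{R}^n\mid\nabla_{\bm{x}}U(\bm{x})=\bm{0}\}$, one has $N_V=N_U$.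
   Context: $\#(\cdot)$ denotes the cardinality of a set. A diffeomorphism is a bijective smooth map whose inverse is also smooth; here $\phi$ is a diffeomorphism from $\mathbb{R}^n$ onto $\mathbb{R}^n$. *)

(* Defs.v *)
From HB Require Import structures.
From mathcomp Require Import all_boot all_order all_algebra.
From mathcomp Require Import all_classical all_reals all_analysis.
Set Implicit Arguments.
Unset Strict Implicit.
Unset Printing Implicit Defensive.
Import Order.TTheory GRing.Theory Num.Theory.
Import numFieldNormedType.Exports.
Local Open Scope classical_set_scope.
Local Open Scope ring_scope.

Definition partial (R : realType) (n : nat) (W : normedModType R)
  (i : 'I_n) (f : 'rV[R]_n -> W) : 'rV[R]_n -> W :=
  fun x => 'D_(delta_mx 0 i) f x.

(* C^(k+1): Frechet differentiable everywhere, with a differential of class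
   C^k.  In finite dimension the latter amounts to the partial derivatives, i.e.
   the entries of the differential in the standard basis, being of class C^k. *)
Fixpoint class_C (R : realType) (n : nat) (W : normedModType R) (k : nat)
  (f : 'rV[R]_n -> W) : Prop :=
  match k with
  | 0 => continuous f
  | k'.+1 => (forall x, differentiable f x) /\
             (forall i, class_C k' (partial i f))
  end.

Definition smooth (R : realType) (n : nat) (W : normedModType R)
  (f : 'rV[R]_n -> W) : Prop := forall k, class_C k f.

Definition gradient (R : realType) (n : nat) (V : 'rV[R]_n -> R)
  (x : 'rV[R]_n) : 'rV[R]_n := \row_i partial i V x.

Definition gradient_roots (R : realType) (n : nat) (V : 'rV[R]_n -> R) :
  set 'rV[R]_n := [set x | gradient V x = 0].

Definition diffeomorphism (R : realType) (n : nat)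
  (phi : 'rV[R]_n -> 'rV[R]_n) : Prop :=
  smooth phi /\
  exists psi : 'rV[R]_n -> 'rV[R]_n,
    [/\ cancel phi psi, cancel psi phi & smooth psi].

(* As the library's maps act on row vectors, 'J phi x is the transpose of the
   matrix (d phi_i / d x_j)_(i, j); the determinant is the same. *)
Definition orientation_preserving_diffeomorphism (R : realType) (n : nat)
  (phi : 'rV[R]_n -> 'rV[R]_n) : Prop :=
  diffeomorphism phi /\ forall x, 0 < \det ('J phi x).

(* Main.v *)
(* By the chain rule, [x] is critical for [V \o phi] as soon as [phi x] is
   critical for [V]; applied to [V \o phi] and the inverse of [phi] this gives
   the converse, so [phi] restricts to a bijection between the critical sets. *)
Require Import Defs.
From HB Require Import structures.
From mathcomp Require Import all_boot all_order all_algebra.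
From mathcomp Require Import all_classical all_reals all_analysis.
Set Implicit Arguments.
Unset Strict Implicit.
Unset Printing Implicit Defensive.
Import Order.TTheory GRing.Theory Num.Theory.
Import numFieldNormedType.Exports.
Local Open Scope classical_set_scope.
Local Open Scope card_scope.
Local Open Scope ring_scope.

Lemma smooth_differentiable (R : realType) (n : nat) (W : normedModType R)
  (f : 'rV[R]_n -> W) (x : 'rV[R]_n) : smooth f -> differentiable f x.
Proof. by move=> /(_ 1%N)[]. Qed.

(** The differential is linear, hence determined by its values on the basis vectors [delta_mx 0 i];
    these values are the partial derivatives. *)
Lemma gradient_eq0 (R : realType) (n : nat) (V : 'rV[R]_n -> R)
  (x : 'rV[R]_n) : differentiable V x ->
  gradient V x = 0 <-> forall v, 'd V x v = 0.
Proof.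
move=> dV; split=> [/rowP gV0 v|dV0].
  rewrite (row_sum_delta v) linear_sum big1 // => i _.
  have := gV0 i; rewrite !mxE /partial => DiV0.
  by rewrite linearZ /= -deriveE // DiV0 scaler0.
by apply/rowP => i; rewrite !mxE /partial deriveE.
Qed.

(** Kept pointwise, without invertibility, so that it serves for [phi] and for its inverse alike. *)
Lemma gradient_roots_comp (R : realType) (n : nat) (V : 'rV[R]_n -> R)
  (phi : 'rV[R]_n -> 'rV[R]_n) (x : 'rV[R]_n) :
  differentiable phi x -> differentiable V (phi x) ->
  gradient_roots V (phi x) -> gradient_roots (V \o phi) x.
Proof.
move=> dphi dV /(gradient_eq0 dV) dV0.
apply/(gradient_eq0 (differentiable_comp dphi dV)) => v.
by rewrite diff_comp //=.
Qed.

Theorem proposition3p1 (R : realType) (n : nat)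
  (V : 'rV[R]_n -> R) (phi : 'rV[R]_n -> 'rV[R]_n)
  (hV : smooth V)
  (hphi : orientation_preserving_diffeomorphism phi) :
  gradient_roots V #= gradient_roots (V \o phi).
Proof.
case: hphi => -[sphi [psi [phiK psiK spsi]]] _.
(* An injective map preserves the cardinality of a set, so an equality of sets suffices. *)
suff -> : gradient_roots V = phi @` gradient_roots (V \o phi).
  exact: inj_card_eq (in2W (can_inj phiK)).
apply/seteqP; split=> [y Vy|_ [x Ux <-]].
  exists (psi y); last exact: psiK.
  by apply: gradient_roots_comp; rewrite ?psiK //; exact: smooth_differentiable.
(* Undoing [phi] by [psi] turns the converse into the same chain rule, at the point [phi x]. *)
have -> : V = (V \o phi) \o psi by apply/funext => y /=; rewrite psiK.
apply: gradient_roots_comp; first exact: smooth_differentiable.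
  by apply: differentiable_comp; exact: smooth_differentiable.
by rewrite phiK.
Qed.
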